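(* Suppose that for every $\mu\in[\mu_0,\delta^{-1}]$ there is a global maximizer $(\varsigma_\mu,\sigma_\mu)\in\mathcal S_\mu^+$ of $P_\mu^d$ over $\mathcal S_\mu^+$. Then $$\min_{x\in\mathcal X}P_0(x)=\min_{\mu\in[\mu_0,\delta^{-1}]}P_\mu^d(\varsigma_\mu,\sigma_\mu).$$
   Context: Data: $n,m\ge 1$; $B\in\mathbb R^{m\times n}$; $Q\in\mathbb R^{n\times n}$ symmetric; $H\in\mathbb R^{n\times n}$ (symmetric) negative definite; $\lambda\in\mathbb R$, $\lambda>0$; $f,b\in\mathbb R^n$. $|\cdot|$ is the Euclidean norm. Define, for $x\in\mathbb R^n$, $$g(x)=\tfrac12\left(\tfrac12|Bx|^2-\lambda\right)^2,\qquad h(x)=\tfrac12x^THx-b^Tx .$$ Assume $h(H^{-1}b)>0$, define $\mu_0>0$ by $\mu_0^{-1}=h(H^{-1}b)$, and fix $\delta\in(0,\mu_0^{-1}]$. Let $$\mathcal X=\{x\in\mathbb R^n:h(x)\ge\delta\},\qquad P_0(x)=\tfrac12x^TQx-f^Tx+\frac{g(x)}{h(x)}\quad(x\in\mathcal X).$$ For $\mu\in[\mu_0,\delta^{-1}]$ let $$G_\mu(\varsigma,\sigma)=Q+\mu\varsigma B^TB-\sigma H,\qquad \mathcal S_\mu^+=\{(\varsigma,\sigma)\in\mathbb R^2:\varsigma\ge-\lambda,\ \sigma\ge0,\ G_\mu(\varsigma,\sigma)\succ0\},$$ where $\succ0$ means positive definite, and for $(\varsigma,\sigma)\in\mathcal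 S_\mu^+$ let $$P_\mu^d(\varsigma,\sigma)=-\tfrac12(f-\sigma b)^TG_\mu(\varsigma,\sigma)^{-1}(f-\sigma b)-\mu\lambda\varsigma-\tfrac{\mu}{2}\varsigma^2+\tfrac{\sigma}{\mu}.$$ *)

(* Defs.v *)
From HB Require Import structures.
From mathcomp Require Import all_boot all_order all_algebra sesquilinear.
From mathcomp Require Import all_classical reals.
Set Implicit Arguments.
Unset Strict Implicit.
Unset Printing Implicit Defensive.
Import Order.TTheory GRing.Theory Num.Theory.
Local Open Scope classical_set_scope.
Local Open Scope ring_scope.

Definition dotcv (R : realType) (n : nat) (u v : 'cV[R]_n) : R :=
  (u^T *m v) 0 0.

(* The norm [`| x |] that MathComp-Analysis puts on matrices is the sup norm,
   hence a separate definition. *)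
Definition enorm (R : realType) (n : nat) (x : 'cV[R]_n) : R :=
  Num.sqrt (dotcv x x).

Definition qform (R : realType) (n : nat) (A : 'M[R]_n) (x : 'cV[R]_n) : R :=
  (x^T *m A *m x) 0 0.

Definition posdefmx (R : realType) (n : nat) (A : 'M[R]_n) : Prop :=
  A \is symmetricmx /\ (forall x : 'cV[R]_n, x != 0 -> 0 < qform A x).

Definition negdefmx (R : realType) (n : nat) (A : 'M[R]_n) : Prop :=
  A \is symmetricmx /\ (forall x : 'cV[R]_n, x != 0 -> qform A x < 0).

Definition is_min (R : realType) (A : set R) (v : R) : Prop :=
  A v /\ lbound A v.

Definition is_argmax (R : realType) (T : Type) (F : T -> R) (S : set T)
    (p : T) : Prop :=
  S p /\ (forall q : T, S q -> F q <= F p).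

Definition gfun (R : realType) (m n : nat) (B : 'M[R]_(m, n)) (lambda : R)
    (x : 'cV[R]_n) : R :=
  2^-1 * (2^-1 * enorm (B *m x) ^+ 2 - lambda) ^+ 2.

Definition hfun (R : realType) (n : nat) (H : 'M[R]_n) (b x : 'cV[R]_n) : R :=
  2^-1 * qform H x - dotcv b x.

Definition Xset (R : realType) (n : nat) (H : 'M[R]_n) (b : 'cV[R]_n)
    (delta : R) : set 'cV[R]_n :=
  [set x | delta <= hfun H b x].

(* Only meaningful on [Xset H b delta] with [0 < delta], where the denominator
   is positive. *)
Definition P0 (R : realType) (m n : nat) (B : 'M[R]_(m, n)) (Q H : 'M[R]_n)
    (lambda : R) (f b x : 'cV[R]_n) : R :=
  2^-1 * qform Q x - dotcv f x + gfun B lambda x / hfun H b x.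

Definition Gmx (R : realType) (m n : nat) (B : 'M[R]_(m, n)) (Q H : 'M[R]_n)
    (mu varsigma sigma : R) : 'M[R]_n :=
  Q + (mu * varsigma) *: (B^T *m B) - sigma *: H.

(* Dual variables are pairs (varsigma, sigma). *)
Definition Splus (R : realType) (m n : nat) (B : 'M[R]_(m, n)) (Q H : 'M[R]_n)
    (lambda mu : R) : set (R * R) :=
  [set p | [/\ - lambda <= p.1, 0 <= p.2 & posdefmx (Gmx B Q H mu p.1 p.2)]].

(* Only meaningful on [Splus B Q H lambda mu], where [Gmx] is invertible. *)
Definition Pd (R : realType) (m n : nat) (B : 'M[R]_(m, n)) (Q H : 'M[R]_n)
    (lambda : R) (f b : 'cV[R]_n) (mu : R) (p : R * R) : R :=
  - (2^-1 * qform (invmx (Gmx B Q H mu p.1 p.2)) (f - p.2 *: b))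
  - mu * lambda * p.1 - mu / 2 * p.1 ^+ 2 + p.2 / mu.

(* Main.v *)
(* Fix mu and put P_mu = x^T Q x / 2 - f^T x + mu g.  The Lagrangian whose
   infimum over x is P_mu^d (varsigma, sigma) equals P_mu(x) minus a square plus
   sigma (1 / mu - h(x)), so P_mu^d is below P_mu on {h >= 1 / mu}.  At a
   maximizer of P_mu^d the infimum is attained at some x, and the first-order
   conditions say that the square vanishes (also when varsigma = - lambda), that
   h(x) >= 1 / mu and that complementary slackness holds; hence the maximum of
   P_mu^d is the minimum of P_mu over {h >= 1 / mu}.  On this set P_0 <= P_mu,
   with equality where h = 1 / mu.  Minimizing over mu gives the minimum of P_0,
   which exists because X is compact, at mu = 1 / h(x) for a minimizer x. *)
Require Import Defs.
From HB Require Import structures.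
From mathcomp Require Import all_boot all_order all_algebra sesquilinear.
From mathcomp Require Import all_classical reals.
From mathcomp Require Import topology normedtype derive.
From mathcomp Require Import ring lra.
Set Implicit Arguments.
Unset Strict Implicit.
Unset Printing Implicit Defensive.
Import Order.TTheory GRing.Theory Num.Theory.
Import numFieldNormedType.Exports.
Local Open Scope classical_set_scope.
Local Open Scope ring_scope.

(** * Inner products and quadratic forms *)

Lemma dotcvE (R : realType) n (u v : 'cV[R]_n) :
  dotcv u v = \sum_i u i 0 * v i 0.
Proof. by rewrite /dotcv mxE; apply: eq_bigr => i _; rewrite mxE. Qed.

Lemma dotcvC (R : realType) n (u v : 'cV[R]_n) : dotcv u v = dotcv v u.
Proof. by rewrite !dotcvE; apply: eq_bigr => i _; rewrite mulrC. Qed.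

Lemma dotcvDr (R : realType) n (u v w : 'cV[R]_n) :
  dotcv u (v + w) = dotcv u v + dotcv u w.
Proof. by rewrite /dotcv mulmxDr mxE. Qed.

Lemma dotcvZr (R : realType) n (u v : 'cV[R]_n) a :
  dotcv u (a *: v) = a * dotcv u v.
Proof. by rewrite /dotcv -scalemxAr mxE. Qed.

Lemma dotcvNr (R : realType) n (u v : 'cV[R]_n) :
  dotcv u (- v) = - dotcv u v.
Proof. by rewrite -scaleN1r dotcvZr mulN1r. Qed.

Lemma dotcvDl (R : realType) n (u v w : 'cV[R]_n) :
  dotcv (u + v) w = dotcv u w + dotcv v w.
Proof. by rewrite dotcvC dotcvDr !(dotcvC w). Qed.

Lemma dotcvZl (R : realType) n (u v : 'cV[R]_n) a :
  dotcv (a *: u) v = a * dotcv u v.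
Proof. by rewrite dotcvC dotcvZr dotcvC. Qed.

Lemma dotcvNl (R : realType) n (u v : 'cV[R]_n) :
  dotcv (- u) v = - dotcv u v.
Proof. by rewrite dotcvC dotcvNr dotcvC. Qed.

Definition dotcv_lin := (dotcvDl, dotcvDr, dotcvNl, dotcvNr, dotcvZl, dotcvZr).

Lemma dotcv_ge0 (R : realType) n (u : 'cV[R]_n) : 0 <= dotcv u u.
Proof. by rewrite dotcvE sumr_ge0 // => i _; rewrite -expr2 sqr_ge0. Qed.

Lemma dotcv_mulmxl (R : realType) m n (A : 'M[R]_(m, n)) x y :
  dotcv (A *m x) y = dotcv x (A^T *m y).
Proof. by rewrite /dotcv trmx_mul mulmxA. Qed.

Lemma qformE (R : realType) n (A : 'M[R]_n) x : qform A x = dotcv x (A *m x).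
Proof. by rewrite /qform /dotcv mulmxA. Qed.

Lemma sqr_enorm (R : realType) n (x : 'cV[R]_n) : enorm x ^+ 2 = dotcv x x.
Proof. by rewrite /enorm sqr_sqrtr // dotcv_ge0. Qed.

Lemma symmetricmxP (R : realType) n (A : 'M[R]_n) :
  reflect (A^T = A) (A \is symmetricmx).
Proof.
by rewrite qualifE /= expr0 scale1r map_mx_id // eq_sym; apply: eqP.
Qed.

Lemma dotcv_sym (R : realType) n (A : 'M[R]_n) x y :
  A \is symmetricmx -> dotcv x (A *m y) = dotcv y (A *m x).
Proof. by move=> /symmetricmxP sA; rewrite dotcvC dotcv_mulmxl sA. Qed.

(** * Positive definite matrices *)

Lemma posdefmx_ge0 (R : realType) n (A : 'M[R]_n) x :
  posdefmx A -> 0 <= qform A x.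
Proof.
move=> [_ pA]; have [->|/pA/ltW//] := eqVneq x 0.
by rewrite /qform mulmx0 mxE.
Qed.

(** A nonzero row of the left kernel, once transposed, would be a nonzero vector on which the form
    vanishes. *)
Lemma posdefmx_unit (R : realType) n (A : 'M[R]_n) :
  posdefmx A -> A \in unitmx.
Proof.
move=> [_ pA]; rewrite -row_free_unit -kermx_eq0; apply/eqP/row_matrixP => i.
rewrite row0; apply/eqP; apply: contraT => /eqP r0.
have xn0 : (row i (kermx A))^T != 0.
  by apply/eqP => /(congr1 trmx); rewrite trmxK trmx0.
have := pA _ xn0; rewrite /qform trmxK -row_mul mulmx_ker row0 mul0mx mxE.
by rewrite ltxx.
Qed.

Lemma posdefmxN (R : realType) n (H : 'M[R]_n) :
  negdefmx H -> posdefmx (- H).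
Proof.
move=> [/symmetricmxP sH nH]; split.
  by apply/symmetricmxP; rewrite linearN /= sH.
by move=> x /nH; rewrite !qformE mulNmx dotcvNr oppr_gt0.
Qed.

(** Cauchy-Schwarz for the inner product defined by [G]: with [l = G *m z], [dotcv l y] is the
    [G]-product of [z] and [y]. *)
Lemma posdefmx_dot_bound (R : realType) n (G : 'M[R]_n) (l : 'cV[R]_n) :
  posdefmx G -> exists2 L, 0 < L & forall y, dotcv l y ^+ 2 <= L * qform G y.
Proof.
move=> pG; have [sG _] := pG; set z := invmx G *m l.
have lE : l = G *m z by rewrite mulKVmx // posdefmx_unit.
have q0 := posdefmx_ge0 z pG.
(* The summand 1 keeps the constant positive when [l = 0]. *)
exists (qform G z + 1); first by rewrite ltr_wpDl.
move=> y; have y0 := posdefmx_ge0 y pG.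
suff : dotcv l y ^+ 2 <= qform G z * qform G y by nra.
have [z0|zn0] := eqVneq z 0.
  by rewrite lE z0 mulmx0 dotcvC /dotcv /qform !mulmx0 mxE expr0n mul0r.
have z_gt0 : 0 < qform G z by case: pG => _; apply.
have := posdefmx_ge0 (qform G z *: y - dotcv l y *: z) pG.
have -> : qform G (qform G z *: y - dotcv l y *: z) =
    qform G z * (qform G z * qform G y - dotcv l y ^+ 2).
  rewrite {1}qformE mulmxBr -!scalemxAr !dotcv_lin -!qformE.
  rewrite (dotcv_sym z y sG) -lE (dotcvC y l); ring.
by rewrite pmulr_rge0 // subr_ge0.
Qed.

(** The form of [M] is the sum of the products [y i 0 * (M *m y) i 0]. Both factors are linear in
    [y], so their squares are controlled by [posdefmx_dot_bound], and [p * q <= p ^+ 2 + q ^+ 2] for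
    nonnegative [p] and [q]. *)
Lemma posdefmx_qform_bound (R : realType) n (G M : 'M[R]_n) :
  posdefmx G -> exists2 K, 0 < K & forall y, `|qform M y| <= K * qform G y.
Proof.
move=> pG.
have /choice[L LP] : forall l : 'cV[R]_n, exists L,
    0 <= L /\ forall y, dotcv l y ^+ 2 <= L * qform G y.
  by move=> l; have [L /ltW ? ?] := posdefmx_dot_bound l pG; exists L.
pose c i := L (delta_mx i 0) + L (row i M)^T.
exists (\sum_i c i + 1).
  by rewrite ltr_wpDl // sumr_ge0 // => i _; rewrite addr_ge0 // (LP _).1.
move=> y; rewrite mulrDl mul1r -[leLHS]addr0 lerD ?posdefmx_ge0 //.
rewrite {1}qformE dotcvE mulr_suml (le_trans (ler_norm_sum _ _ _)) // ler_sum //.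
move=> i _; rewrite normrM /c mulrDl.
have := (LP (delta_mx i 0)).2 y; have := (LP (row i M)^T).2 y.
rewrite /dotcv trmxK -row_mul mxE.
rewrite (_ : (_^T *m y) 0 0 = y i 0); last first.
  by rewrite trmx_delta -rowE mxE.
rewrite -(real_normK (num_real (y i 0))) -(real_normK (num_real ((M *m y) i 0))).
have : 0 <= (`|y i 0| - `|(M *m y) i 0|) ^+ 2 by rewrite sqr_ge0.
have : 0 <= `|y i 0| * `|(M *m y) i 0| by rewrite mulr_ge0.
rewrite sqrrB.
move: (`|y i 0|) (`|(M *m y) i 0|) => p q; lra.
Qed.

(** * Minimal value of a quadratic function and its perturbation *)

(* For [G] positive definite the infimum over [x] of
   [qform G x / 2 - dotcv c x] is the value of the following function. *)
Definition qdual (R : realType) n (G : 'M[R]_n) (c : 'cV[R]_n) : R :=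
  - (2^-1 * qform (invmx G) c).

Lemma qdual_square (R : realType) n (G : 'M[R]_n) (c x : 'cV[R]_n) :
  posdefmx G ->
  2^-1 * qform G x - dotcv c x =
    qdual G c + 2^-1 * qform G (x - invmx G *m c).
Proof.
move=> pG; have uG := posdefmx_unit pG.
have [sG _] := pG.
rewrite /qdual !qformE mulmxBr mulKVmx // !dotcv_lin.
rewrite (dotcvC (invmx G *m c) (G *m x)) dotcv_mulmxl (symmetricmxP _ sG).
by rewrite mulKVmx // (dotcvC (invmx _ *m _)) (dotcvC x c); field.
Qed.

Lemma qdual_le (R : realType) n (G : 'M[R]_n) (c x : 'cV[R]_n) :
  posdefmx G -> qdual G c <= 2^-1 * qform G x - dotcv c x.
Proof.
by move=> pG; rewrite (qdual_square c x pG) lerDl mulr_ge0 ?invr_ge0 ?posdefmx_ge0.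
Qed.

Lemma qdual_attained (R : realType) n (G : 'M[R]_n) (c : 'cV[R]_n) :
  posdefmx G -> let x := invmx G *m c in
  qdual G c = 2^-1 * qform G x - dotcv c x.
Proof.
move=> pG x; rewrite (qdual_square c x pG) subrr /qform mulmx0 mxE.
by rewrite mulr0 addr0.
Qed.

(* The quadratic term makes the gradient usable in the first-order conditions
   without differentiating [invmx]. *)
Lemma qdual_perturb (R : realType) n (G M : 'M[R]_n) (c e : 'cV[R]_n) :
  posdefmx G -> M \is symmetricmx -> let x := invmx G *m c in
  exists2 eps, 0 < eps & exists2 C, 0 < C & forall t, `|t| <= eps ->
    posdefmx (G + t *: M) /\
    qdual G c + t * (2^-1 * qform M x - dotcv e x) - C * t ^+ 2
      <= qdual (G + t *: M) (c + t *: e).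
Proof.
move=> pG sM x.
have [K K0 KP] := posdefmx_qform_bound M pG.
have [L L0 LP] := posdefmx_dot_bound (M *m x - e) pG.
(* For such [t] the perturbation costs at most half of the form of [G], so [G + t *: M] stays
   positive definite. *)
have bound t y : `|t| <= (2 * K)^-1 ->
    2^-1 * qform G y <= qform G y + t * qform M y.
  move=> tK.
  have : `|t * qform M y| <= 2^-1 * qform G y.
    have -> : 2^-1 * qform G y = (2 * K)^-1 * (K * qform G y).
      by field; rewrite gt_eqF.
    by rewrite normrM ler_pM.
  rewrite ler_norml => /andP[+ _]; lra.
exists (2 * K)^-1; first by rewrite invr_gt0 mulr_gt0.
exists L => // t /bound {}bound.
have qE y : qform (G + t *: M) y = qform G y + t * qform M y.
  by rewrite !qformE mulmxDl -scalemxAl !dotcv_lin.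
have pGt : posdefmx (G + t *: M).
  have [sG G0] := pG; split.
    apply/symmetricmxP; rewrite linearD linearZ /=.
    by rewrite (symmetricmxP _ sG) (symmetricmxP _ sM).
  move=> y /G0 y0; rewrite qE; apply: lt_le_trans (bound y).
  by rewrite mulr_gt0 ?invr_gt0.
split=> //; rewrite (qdual_attained _ pGt); set z := invmx _ *m _.
have -> : 2^-1 * qform (G + t *: M) z - dotcv (c + t *: e) z =
  2^-1 * qform G z - dotcv c z + t * (2^-1 * qform M z - dotcv e z).
  by rewrite qE !dotcv_lin; ring.
(* Both quadratics are expanded around the old minimizer [x], with [z] the new one. With [q] the
   [G]-form of [z - x], half of [q] enters with a plus sign: [bound] spends a quarter of [q] on the
   [M]-form of [z - x], and the other quarter absorbs the cross term [t * w] up to [L * t ^+ 2]. *)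
rewrite (qdual_square c z pG) -/x.
have -> : 2^-1 * qform M z - dotcv e z = 2^-1 * qform M x - dotcv e x
   + dotcv (M *m x - e) (z - x) + 2^-1 * qform M (z - x).
  rewrite !qformE mulmxBr !dotcv_lin (dotcv_sym x z sM).
  by rewrite (dotcvC (M *m x)) (dotcvC (M *m x)); field.
have := bound (z - x); have := LP (z - x).
move: (qform G _) (dotcv (_ - _) _) (qform M (z - x)) => q w r wq qr.
have : 0 <= (w / L / 2 + t) ^+ 2 * L by rewrite mulr_ge0 ?sqr_ge0 ?ltW.
have -> : (w / L / 2 + t) ^+ 2 * L = w ^+ 2 / L / 4 + t * w + L * t ^+ 2.
  by field; rewrite gt_eqF.
have : w ^+ 2 / L <= q by rewrite ler_pdivrMr // mulrC.
lra.
Qed.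

(** * Lagrangian duality for fixed [mu] *)

Definition Pmu (R : realType) (m n : nat) (B : 'M[R]_(m, n)) (Q : 'M[R]_n)
    (lambda : R) (f : 'cV[R]_n) (mu : R) (x : 'cV[R]_n) : R :=
  2^-1 * qform Q x - dotcv f x + mu * gfun B lambda x.

Lemma qform_gram (R : realType) (m n : nat) (B : 'M[R]_(m, n)) x :
  qform (B^T *m B) x = enorm (B *m x) ^+ 2.
Proof. by rewrite sqr_enorm dotcv_mulmxl qformE mulmxA. Qed.

(** If [a] were positive, [t = min(eps, a / (2 * C))] would give [t * a <= C * t ^+ 2 <= t * a / 2].
    Only [t >= 0] is tested, so the lemma also applies at the boundary of the dual domain. *)
Lemma first_order_le0 (R : realFieldType) (a C eps : R) : 0 < C -> 0 < eps ->
  (forall t, 0 <= t <= eps -> t * a <= C * t ^+ 2) -> a <= 0.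
Proof.
move=> C0 e0 H; rewrite leNgt; apply/negP => a0.
pose t := Num.min eps (a / (2 * C)).
have t0 : 0 < t by rewrite lt_min e0 divr_gt0 // mulr_gt0.
have tC : t * (2 * C) <= a.
  by rewrite -ler_pdivlMr ?mulr_gt0 // ge_min lexx orbT.
have := H t; rewrite (ltW t0) ge_min lexx => /(_ isT).
rewrite expr2 mulrCA ler_pM2l //; lra.
Qed.

Section Duality.
Variables (R : realType) (m n : nat) (B : 'M[R]_(m, n)) (Q H : 'M[R]_n).
Variables (lambda : R) (f b : 'cV[R]_n) (mu : R).
Hypotheses (mu_gt0 : 0 < mu) (H_sym : H \is symmetricmx).

Let Pdual := Pd B Q H lambda f b mu.
Let dom := Splus B Q H lambda mu.
Let primal := Pmu B Q lambda f mu.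
Let h := hfun H b.
Let xi x := 2^-1 * enorm (B *m x) ^+ 2.

Lemma PdE p : Pdual p = qdual (Gmx B Q H mu p.1 p.2) (f - p.2 *: b)
  - mu * lambda * p.1 - mu / 2 * p.1 ^+ 2 + p.2 / mu.
Proof. by []. Qed.

(** Completing the square in [s]: [s * (xi x - lambda) - s ^+ 2 / 2] is half of
    [(xi x - lambda) ^+ 2] minus half of [(xi x - lambda - s) ^+ 2], and [mu] times the former half
    is [mu * gfun B lambda x]. *)
Lemma lagrangianE s r x :
  2^-1 * qform (Gmx B Q H mu s r) x - dotcv (f - r *: b) x
    - mu * lambda * s - mu / 2 * s ^+ 2 + r / mu
  = primal x - mu / 2 * (xi x - lambda - s) ^+ 2 + r * (mu^-1 - h x).
Proof.
rewrite /primal /Pmu /gfun /h /hfun -/(xi x) !qformE /Gmx mulmxBl mulmxDl.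
rewrite -!scalemxAl !dotcv_lin -(qformE (B^T *m B)) qform_gram.
have -> : enorm (B *m x) ^+ 2 = 2 * xi x by rewrite /xi; field.
by field; rewrite gt_eqF.
Qed.

Lemma weak_duality p x : dom p -> mu^-1 <= h x -> Pdual p <= primal x.
Proof.
move=> [_ r0 pG] hx; rewrite PdE.
have := qdual_le (f - p.2 *: b) x pG; have := lagrangianE p.1 p.2 x.
have : 0 <= mu / 2 * (xi x - lambda - p.1) ^+ 2.
  by rewrite mulr_ge0 ?sqr_ge0 ?divr_ge0 // ltW.
have : p.2 * (mu^-1 - h x) <= 0 by rewrite mulr_ge0_le0 // subr_le0.
lra.
Qed.

(** When [Gmx] is positive definite, this is the minimizer over [x] of the Lagrangian at
    [(s, r)]. *)
Let xbar s r := invmx (Gmx B Q H mu s r) *m (f - r *: b).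

Lemma Pd_perturb_varsigma s r : posdefmx (Gmx B Q H mu s r) ->
  exists2 eps, 0 < eps & exists2 C, 0 < C & forall t, `|t| <= eps ->
    posdefmx (Gmx B Q H mu (s + t) r) /\
    Pdual (s, r) + t * (mu * (xi (xbar s r) - lambda - s)) - C * t ^+ 2
      <= Pdual (s + t, r).
Proof.
move=> pG.
have sM : mu *: (B^T *m B) \is symmetricmx.
  by apply/symmetricmxP; rewrite linearZ /= trmx_mul trmxK.
have [eps e0 [C C0 HC]] := qdual_perturb (f - r *: b) 0 pG sM.
(* The extra [mu / 2] is the second-order part of the explicit term [- mu / 2 * s ^+ 2]. *)
exists eps => //; exists (C + mu / 2); first by rewrite addr_gt0 // divr_gt0.
have GE t : Gmx B Q H mu (s + t) r = Gmx B Q H mu s r + t *: (mu *: (B^T *m B)).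
  by rewrite /Gmx mulrDr scalerDl scalerA (mulrC t) addrA [RHS]addrAC.
move=> t /HC; rewrite -GE scaler0 addr0 => -[pGt le_qd]; split=> //.
move: le_qd; rewrite -/(xbar s r) !PdE /= qformE -scalemxAl dotcvZr -qformE.
rewrite qform_gram (_ : enorm _ ^+ 2 = 2 * xi (xbar s r)); last first.
  by rewrite /xi; field.
rewrite /dotcv trmx0 mul0mx mxE; lra.
Qed.

Lemma Pd_perturb_sigma s r : posdefmx (Gmx B Q H mu s r) ->
  exists2 eps, 0 < eps & exists2 C, 0 < C & forall t, `|t| <= eps ->
    posdefmx (Gmx B Q H mu s (r + t)) /\
    Pdual (s, r) + t * (mu^-1 - h (xbar s r)) - C * t ^+ 2
      <= Pdual (s, r + t).
Proof.
move=> pG.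
have sM : - H \is symmetricmx.
  by apply/symmetricmxP; rewrite linearN /= (symmetricmxP _ H_sym).
(* In the direction [(- H, - b)] the first-order coefficient is exactly [- h (xbar s r)]. *)
have [eps e0 [C C0 HC]] := qdual_perturb (f - r *: b) (- b) pG sM.
have GE t : Gmx B Q H mu s (r + t) = Gmx B Q H mu s r + t *: - H.
  by rewrite /Gmx scalerDl opprD addrA scalerN.
have cE t : f - (r + t) *: b = f - r *: b + t *: - b.
  by rewrite scalerDl opprD addrA scalerN.
exists eps => //; exists C => // t /HC.
rewrite -GE -cE -/(xbar s r) => -[pGt le_qd]; split=> //.
move: le_qd; rewrite !PdE /= /h /hfun !qformE mulNmx !dotcv_lin.
lra.
Qed.

Lemma dual_max_stationary s r : is_argmax Pdual dom (s, r) ->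
  let x := xbar s r in
  s = xi x - lambda /\ mu^-1 <= h x /\ r * (mu^-1 - h x) = 0.
Proof.
move=> smax x; have [[/= s_ge r_ge pG] {}smax] := smax.
have xi0 : 0 <= xi x by rewrite mulr_ge0 ?invr_ge0 ?sqr_ge0.
split.
- have [eps e0 [C C0 HC]] := Pd_perturb_varsigma pG.
  have up t : `|t| <= eps -> - lambda <= s + t ->
      t * (mu * (xi x - lambda - s)) <= C * t ^+ 2.
    move=> /HC [pGt le_t] st.
    have /smax : dom (s + t, r) by [].
    rewrite -/x in le_t; lra.
  have le0 : mu * (xi x - lambda - s) <= 0.
    apply: first_order_le0 C0 e0 _ => t /andP[t0 te].
    by apply: up; [rewrite ger0_norm | rewrite ler_wpDr].
  rewrite pmulr_rle0 // in le0.
  (* At the boundary [s = - lambda], [le0] reads [xi x <= 0]; with [xi0] this forces [xi x = 0], so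
     the equation still holds. *)
  move: s_ge; rewrite le_eqVlt => /predU1P[sE|s_gt]; first lra.
  suff : - (mu * (xi x - lambda - s)) <= 0.
    by rewrite oppr_le0 pmulr_rge0 //; lra.
  (* Steps to the left of length at most [s + lambda] stay in the domain. *)
  have e1 : 0 < Num.min eps (s + lambda) by rewrite lt_min e0; lra.
  apply: first_order_le0 C0 e1 _ => t; rewrite le_min => /and3P[t0 te ts].
  rewrite mulrN -mulNr -(sqrrN t); apply: up; last lra.
  by rewrite normrN ger0_norm.
- have [eps e0 [C C0 HC]] := Pd_perturb_sigma pG.
  have up t : `|t| <= eps -> 0 <= r + t -> t * (mu^-1 - h x) <= C * t ^+ 2.
    move=> /HC [pGt le_t] rt.
    have /smax : dom (s, r + t) by [].
    rewrite -/x in le_t; lra.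
  have le0 : mu^-1 - h x <= 0.
    apply: first_order_le0 C0 e0 _ => t /andP[t0 te].
    by apply: up; [rewrite ger0_norm | rewrite addr_ge0].
  split; first by rewrite -subr_le0.
  (* Complementary slackness: for [r > 0] moves in both directions are allowed, so the derivative
     vanishes. *)
  move: r_ge; rewrite le_eqVlt => /predU1P[<-|r_gt]; first by rewrite mul0r.
  suff : - (mu^-1 - h x) <= 0.
    by rewrite oppr_le0 => ge0; rewrite (le_anti (introT andP (conj le0 ge0))) mulr0.
  have e1 : 0 < Num.min eps r by rewrite lt_min e0.
  apply: first_order_le0 C0 e1 _ => t; rewrite le_min => /and3P[t0 te ts].
  rewrite mulrN -mulNr -(sqrrN t); apply: up; last by rewrite subr_ge0.
  by rewrite normrN ger0_norm.
Qed.

Lemma strong_duality s r : is_argmax Pdual dom (s, r) ->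
  exists2 x, mu^-1 <= h x & Pdual (s, r) = primal x.
Proof.
move=> smax; have [sE [hx rE]] := dual_max_stationary smax.
have [[/= _ _ pG] _] := smax; exists (xbar s r) => //.
rewrite PdE qdual_attained // -/(xbar s r) lagrangianE rE -sE.
by rewrite subrr expr0n mulr0 subr0 addr0.
Qed.
End Duality.

(** * Geometry of the feasible set *)

(** This is [qdual_square] for [- H] and [- b], whose minimizer is again [invmx H *m b]. *)
Lemma hfun_square (R : realType) n (H : 'M[R]_n) (b x : 'cV[R]_n) :
  negdefmx H ->
  hfun H b x = hfun H b (invmx H *m b)
    - 2^-1 * qform (- H) (x - invmx H *m b).
Proof.
move=> nH; have pN := posdefmxN nH.
have uH : H \in unitmx.
  by rewrite -[H]opprK -scaleN1r unitmxZ ?unitrN ?unitr1 // posdefmx_unit.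
have xE : invmx (- H) *m (- b) = invmx H *m b.
  apply: (can_inj (mulKmx (posdefmx_unit pN))).
  by rewrite mulKVmx ?posdefmx_unit // mulNmx mulKVmx.
have hE y : hfun H b y = - (2^-1 * qform (- H) y - dotcv (- b) y).
  by rewrite /hfun !qformE mulNmx !dotcv_lin; ring.
rewrite hE (qdual_square _ x pN) xE -{2}xE hE -qdual_attained //; ring.
Qed.

Lemma hfun_le_max (R : realType) n (H : 'M[R]_n) (b x : 'cV[R]_n) :
  negdefmx H -> hfun H b x <= hfun H b (invmx H *m b).
Proof.
move=> nH; rewrite (hfun_square b x nH) gerBl mulr_ge0 ?invr_ge0 //.
exact/posdefmx_ge0/posdefmxN.
Qed.

(** By [hfun_square] the set is an ellipsoid around [x0]; [posdefmx_dot_bound] for the basis vectors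
    bounds each coordinate. *)
Lemma Xset_bounded (R : realType) n (H : 'M[R]_n) (b : 'cV[R]_n) delta :
  negdefmx H ->
  exists M, forall x i, Xset H b delta x -> `|x i 0| <= M.
Proof.
move=> nH; have pN := posdefmxN nH; set x0 := invmx H *m b.
have /choice[L LP] : forall i, exists L,
    0 <= L /\ forall y : 'cV[R]_n, y i 0 ^+ 2 <= L * qform (- H) y.
  move=> i; have [L /ltW L0 LP] := posdefmx_dot_bound (delta_mx i 0) pN.
  exists L; split=> // y; have := LP y.
  by rewrite /dotcv trmx_delta -rowE mxE.
pose D := 2 * (hfun H b x0 - delta).
(* The bound on squares becomes one on absolute values through [y <= y ^+ 2 + 1]. *)
pose c i := `|x0 i 0| + (L i * D + 1).
have D0 x : Xset H b delta x -> qform (- H) (x - x0) <= D.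
  by rewrite /Xset /= (hfun_square b x nH) -/x0 /D; lra.
have bnd x i : Xset H b delta x -> `|x i 0| <= c i.
  move=> /D0 xD; rewrite -[x](subrK x0) mxE addrC.
  rewrite (le_trans (ler_normD _ _)) // /c lerD2l.
  have [L0 /(_ (x - x0))] := LP i; have := ler_wpM2l L0 xD.
  rewrite -(real_normK (num_real ((x - x0) i 0))).
  have := sqr_ge0 (`|(x - x0) i 0| - 2^-1); rewrite sqrrB.
  move: (`|_|) => y; lra.
exists (\sum_i `|c i|) => x i /bnd xi; apply: le_trans (xi i) _.
by rewrite (bigD1 i) //= (le_trans (ler_norm _)) // lerDl sumr_ge0.
Qed.

(** * Continuity and existence of a minimizer of [P0] *)

(* MathComp-Analysis has compactness of boxes for row vectors only, hence the
   transposes. *)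
Section Continuity.
Variables (R : realType) (n : nat).

Lemma coord_tr_continuous i : continuous (fun v : 'rV[R]_n => v^T i 0).
Proof.
rewrite (_ : (fun _ => _) = (fun v : 'rV[R]_n => v 0 i)).
  exact: coord_continuous.
by apply/funext => v; rewrite mxE.
Qed.

Lemma lin_tr_continuous m (A : 'M[R]_(m, n)) i :
  continuous (fun v : 'rV[R]_n => (A *m v^T) i 0).
Proof.
rewrite (_ : (fun _ => _) = (fun v : 'rV[R]_n => \sum_j A i j * v^T j 0)).
  apply: continuous_big => [|j _ v]; first exact: add_continuous.
  exact: continuousM (@cst_continuous _ _ (A i j) v) (@coord_tr_continuous j v).
by apply/funext => v; rewrite mxE.
Qed.

Lemma dotcv_continuous m (F G : 'rV[R]_n -> 'cV[R]_m) :
  (forall i, continuous (fun v => F v i 0)) ->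
  (forall i, continuous (fun v => G v i 0)) ->
  continuous (fun v => dotcv (F v) (G v)).
Proof.
move=> cF cG.
rewrite (_ : (fun _ => _) = (fun v => \sum_i F v i 0 * G v i 0)).
  apply: continuous_big => [|i _ v]; first exact: add_continuous.
  exact: continuousM (cF i v) (cG i v).
by apply/funext => v; rewrite dotcvE.
Qed.

Lemma quad_tr_continuous (A : 'M[R]_n) (c : 'cV[R]_n) :
  continuous (fun v : 'rV[R]_n => 2^-1 * qform A v^T - dotcv c v^T).
Proof.
have cA : continuous (fun v : 'rV[R]_n => qform A v^T).
  rewrite (_ : (fun _ => _) = (fun v => dotcv v^T (A *m v^T))).
    apply: dotcv_continuous => i; first exact: coord_tr_continuous.
    exact: lin_tr_continuous.
  by apply/funext => w; rewrite qformE.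
have cc : continuous (fun v : 'rV[R]_n => dotcv c v^T).
  apply: dotcv_continuous => i; last exact: coord_tr_continuous.
  exact: cst_continuous.
move=> v.
exact: continuousB (continuousM (@cst_continuous _ R 2^-1 v) (cA v)) (cc v).
Qed.

Lemma gfun_tr_continuous m (B : 'M[R]_(m, n)) lambda :
  continuous (fun v : 'rV[R]_n => gfun B lambda v^T).
Proof.
have cB : continuous (fun v : 'rV[R]_n => enorm (B *m v^T) ^+ 2).
  rewrite (_ : (fun _ => _) = (fun v => dotcv (B *m v^T) (B *m v^T))).
    by apply: dotcv_continuous => i; exact: lin_tr_continuous.
  by apply/funext => w; rewrite sqr_enorm.
have cr v := continuousB
  (continuousM (@cst_continuous _ R 2^-1 v) (cB v)) (@cst_continuous _ _ lambda v).
move=> v.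
exact: continuousM (@cst_continuous _ R 2^-1 v) (continuousM (cr v) (cr v)).
Qed.
End Continuity.

Lemma P0_min_exists (R : realType) (m n : nat) (B : 'M[R]_(m, n))
    (Q H : 'M[R]_n) lambda (f b : 'cV[R]_n) delta :
  negdefmx H -> 0 < delta -> Xset H b delta !=set0 ->
  exists2 x, Xset H b delta x & forall y, Xset H b delta y ->
    P0 B Q H lambda f b x <= P0 B Q H lambda f b y.
Proof.
move=> nH d0 [x1 Xx1].
pose A := [set v : 'rV[R]_n | Xset H b delta v^T].
have [M HM] := Xset_bounded b delta nH.
have cA : compact A.
  apply: (@subclosed_compact _ A
      [set v : 'rV[R]_n | forall i, `[- M, M]%classic (v ord0 i)]).
  - apply: (@closed_comp _ _ (fun v : 'rV[R]_n => hfun H b v^T)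
      [set y | delta <= y]); last exact: closed_ge.
    by move=> v _; exact: quad_tr_continuous.
  - apply: (@rV_compact _ _ (fun=> `[- M, M]%classic)) => _.
    exact: segment_compact.
  - move=> v Av i /=; rewrite in_itv /= -ler_norml.
    by have := HM _ i Av; rewrite mxE.
have A0 : A !=set0 by exists x1^T; rewrite /A /= trmxK.
(* The quotient is continuous on [A] because the denominator is at least [delta > 0] there. *)
have cF : {within A, continuous (fun v : 'rV[R]_n => P0 B Q H lambda f b v^T)}.
  apply: continuous_in_subspaceT => v /set_mem Av; rewrite /P0.
  have h0 : hfun H b v^T != 0 by rewrite gt_eqF // (lt_le_trans d0 Av).
  exact: continuousD (@quad_tr_continuous _ _ Q f v)
    (continuousM (@gfun_tr_continuous _ _ _ B lambda v)
      (@continuousV _ _ (fun w : 'rV[R]_n => hfun H b w^T) v h0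
        (@quad_tr_continuous _ _ H b v))).
have [v /set_mem Av vmin] := compact_EVT_min A0 cA cF.
exists v^T => // y Xy; have := vmin y^T; rewrite trmxK; apply.
by rewrite inE /A /= trmxK.
Qed.

(** * Passage from fixed [mu] to [P0] *)

Lemma gfun_ge0 (R : realType) (m n : nat) (B : 'M[R]_(m, n)) lambda x :
  0 <= gfun B lambda x.
Proof. by rewrite mulr_ge0 ?invr_ge0 ?sqr_ge0. Qed.

Lemma P0_le_Pmu (R : realType) (m n : nat) (B : 'M[R]_(m, n)) (Q H : 'M[R]_n)
    lambda (f b : 'cV[R]_n) mu x :
  0 < mu -> mu^-1 <= hfun H b x ->
  P0 B Q H lambda f b x <= Pmu B Q lambda f mu x.
Proof.
move=> mu0 hx; have h0 : 0 < hfun H b x by rewrite (lt_le_trans _ hx) ?invr_gt0.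
rewrite lerD2l mulrC ler_wpM2r ?gfun_ge0 //.
by rewrite -[leRHS]invrK lef_pV2 ?posrE ?invr_gt0.
Qed.

Theorem corollary1 (R : realType) (m n : nat) (m_ge1 : (1 <= m)%N)
    (n_ge1 : (1 <= n)%N)
    (B : 'M[R]_(m, n)) (Q H : 'M[R]_n) (lambda : R) (f b : 'cV[R]_n)
    (Q_sym : Q \is symmetricmx) (H_negdef : negdefmx H)
    (lambda_gt0 : 0 < lambda)
    (hmax_gt0 : 0 < hfun H b (invmx H *m b))
    (mu0 : R) (mu0_gt0 : 0 < mu0) (mu0_def : mu0^-1 = hfun H b (invmx H *m b))
    (delta : R) (delta_gt0 : 0 < delta) (delta_le : delta <= mu0^-1)
    (varsigma sigma : R -> R)
    (dual_max : forall mu : R, mu0 <= mu <= delta^-1 ->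
      is_argmax (Pd B Q H lambda f b mu) (Splus B Q H lambda mu)
        (varsigma mu, sigma mu)) :
  exists v : R,
    is_min [set P0 B Q H lambda f b x | x in Xset H b delta] v /\
    is_min [set Pd B Q H lambda f b mu (varsigma mu, sigma mu)
             | mu in [set mu : R | mu0 <= mu <= delta^-1]] v.
Proof.
set x0 := invmx H *m b in hmax_gt0 mu0_def.
have [|xs Xxs xsmin] := @P0_min_exists _ _ _ B Q H lambda f b delta H_negdef delta_gt0.
  by exists x0; rewrite /Xset /= -mu0_def.
have dual_ge mu : mu0 <= mu <= delta^-1 ->
    P0 B Q H lambda f b xs <= Pd B Q H lambda f b mu (varsigma mu, sigma mu).
  move=> mu_in; have [mu_ge mu_le] := andP mu_in.
  have mu_gt0 : 0 < mu := lt_le_trans mu0_gt0 mu_ge.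
  have [x hx ->] := strong_duality mu_gt0 H_negdef.1 (dual_max mu mu_in).
  apply: le_trans (P0_le_Pmu _ _ _ _ mu_gt0 hx); apply: xsmin.
  (* The point given by strong duality is feasible since [delta <= mu^-1 <= hfun H b x]. *)
  by apply: le_trans hx; rewrite -[leLHS]invrK lef_pV2 ?posrE ?invr_gt0.
exists (P0 B Q H lambda f b xs); split.
  by split; [exists xs | move=> _ [x Xx <-]; exact: xsmin].
split; last by move=> _ [mu mu_in <-]; exact: dual_ge.
have h_gt0 : 0 < hfun H b xs := lt_le_trans delta_gt0 Xxs.
pose mus := (hfun H b xs)^-1.
(* The two bounds are the inverted forms of [hfun H b xs <= mu0^-1], the maximum of [hfun], and of
   [delta <= hfun H b xs]. *)
have mus_in : mu0 <= mus <= delta^-1.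
  rewrite lef_pV2 ?posrE // Xxs andbT -[mu0]invrK lef_pV2 ?posrE ?invr_gt0 //.
  by rewrite mu0_def hfun_le_max.
exists mus => //; apply/le_anti; rewrite dual_ge // andbT.
(* At [mus] the constraint is tight at [xs], so both primal values agree there and weak duality
   gives the remaining inequality. *)
have -> : P0 B Q H lambda f b xs = Pmu B Q lambda f mus xs.
  by rewrite /P0 /Pmu [mus * _]mulrC.
apply: weak_duality; [by rewrite invr_gt0 | exact: (dual_max _ mus_in).1 |].
by rewrite invrK.
Qed.
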